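(* $\mathrm{ex}(\{M(O_6)\},n) = 2^{n-1} + 4$ for all sufficiently large $n$, where $O_6$ is the octahedral graph.
   Context: A matroid of dimension $m$ is a set $M \subseteq \mathbb{F}_2^m \setminus \{0\}$. A subset of $M \subseteq \mathbb{F}_2^m$ that is the image of $N \subseteq \mathbb{F}_2^k$ under an injective linear map $\mathbb{F}_2^k \to \mathbb{F}_2^m$ is an $N$-restriction of $M$; $M$ is $N$-free if it has no $N$-restriction. $\mathrm{ex}(\{N\},n)$ is the maximum size of an $n$-dimensional $N$-free matroid. For a simple graph $G = (V,E)$, $M(G) \subseteq \mathbb{F}_2^V$ is the matroid consisting of the columns of the $V \times E$ incidence matrix of $G$ over $\mathbb{F}_2$. The octahedral graph $O_6$ is the complete multipartite graph $K_{2,2,2}$ (6 vertices, 12 edges). *)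

(* Defs.v *)
From mathcomp Require Import all_boot all_order all_algebra.
From mathcomp Require Import boolp.

Set Implicit Arguments.
Unset Strict Implicit.
Unset Printing Implicit Defensive.

Import GRing.Theory.
Local Open Scope ring_scope.

(* F_2^m is represented by column vectors. *)
Definition is_matroid (m : nat) (M : {set 'cV['F_2]_m}) : bool := 0 \notin M.

Definition is_restriction (k m : nat) (N : {set 'cV['F_2]_k})
    (M S : {set 'cV['F_2]_m}) : Prop :=
  S \subset M /\
  exists f : {linear 'cV['F_2]_k -> 'cV['F_2]_m}, injective f /\ S = f @: N.

Definition restriction_free (k m : nat) (N : {set 'cV['F_2]_k})
    (M : {set 'cV['F_2]_m}) : Prop :=
  ~ exists S : {set 'cV['F_2]_m}, is_restriction N M S.

(* Whenever N is nonempty the empty matroid is N-free, so this is a maximum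
   over a nonempty family. *)
Definition ex_num (k : nat) (N : {set 'cV['F_2]_k}) (n : nat) : nat :=
  \max_(M : {set 'cV['F_2]_n} | is_matroid M && `[< restriction_free N M >])
    #|M|.

Record simple_graph (V : finType) := SimpleGraph {
  adj :> rel V;
  adj_sym : symmetric adj;
  adj_irr : irreflexive adj
}.

Definition edges (V : finType) (G : simple_graph V) : {set {set V}} :=
  [set [set p.1; p.2] | p in [set p : V * V | G p.1 p.2]].

Definition incidence_column (v : nat) (e : {set 'I_v}) : 'cV['F_2]_v :=
  \col_i (i \in e)%:R.

Definition graphic_matroid (v : nat) (G : simple_graph 'I_v) :
    {set 'cV['F_2]_v} :=
  [set incidence_column e | e in edges G].

Definition multi_adj (V : finType) (I : eqType) (part : V -> I) : rel V :=
  fun u w => part u != part w.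

Fact multi_adj_sym (V : finType) (I : eqType) (part : V -> I) :
  symmetric (multi_adj part).
Proof. by move=> u w; rewrite /multi_adj eq_sym. Qed.

Fact multi_adj_irr (V : finType) (I : eqType) (part : V -> I) :
  irreflexive (multi_adj part).
Proof. by move=> u; rewrite /multi_adj eqxx. Qed.

Definition complete_multipartite (V : finType) (I : eqType) (part : V -> I) :
    simple_graph V :=
  SimpleGraph (multi_adj_sym part) (multi_adj_irr part).

(* K_{2,2,2} on {0,..,5}, with parts {0,1}, {2,3}, {4,5}. *)
Definition O6 : simple_graph 'I_6 :=
  complete_multipartite (fun i : 'I_6 => (i %/ 2)%N).

(* Main.v *)
Require Import Defs.
From mathcomp Require Import all_boot all_order all_algebra.
From mathcomp Require Import boolp zify ring.

(** A copy of [M(O6)] in [M] is a family of six affinely independent vectors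
    [v_0, ..., v_5] with [v_i + v_j] in [M] for every edge [ij] of [O6]: a
    nondegenerate octahedron in the Cayley graph of [M].  Put [N = 2^n].

    Upper bound.  Doubling each vertex of a triangle with Cauchy-Schwarz, an [O6]-free
    [M] has [o(N^2)] pairs [x, y] with [x, y, x + y] in [M].  If moreover [|M| >= N/2],
    the sum of the cubes of the Fourier coefficients together with Parseval yields a
    coefficient below [-7N/16]: [M] almost equals the complement [A] of a hyperplane.
    If [|M| > N/2 + 4], then [M] has five elements in the hyperplane, among them
    a 4-circuit or four independent ones.  The octahedron has cuts whose uncut edges
    form a 4-cycle, resp. two disjoint paths of length two, so these four elements extend
    to an octahedron whose other edges avoid the few missing elements of [A].

    Lower bound.  Add [a, b, a + b, c] to [A]: these neither form a 4-circuit nor are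
    independent, while every cut of the octahedron leaves one of the two. *)

Set Implicit Arguments.
Unset Strict Implicit.
Unset Printing Implicit Defensive.

Import Order.TTheory GRing.Theory Num.Theory.
Local Open Scope ring_scope.

(** * Vectors over F_2 and octahedra as restrictions *)

Lemma F2P (x : 'F_2) : x = 0 \/ x = 1.
Proof.
by case: x => [[|[|m]] lt_m] //; [left | right]; apply: val_inj.
Qed.

Lemma F2_eq1 (x : 'F_2) : (x == 1) = (x != 0).
Proof. by case: (F2P x) => ->. Qed.

Section Vectors.
Variable n : nat.
Local Notation V := 'cV['F_2]_n.

Lemma addF2 (x : V) : x + x = 0.
Proof.
by apply/matrixP => i j; rewrite !mxE; case: (F2P (x i j)) => ->; apply: val_inj.
Qed.

Lemma addF2K (x y : V) : x + y + y = x.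
Proof. by rewrite -addrA addF2 addr0. Qed.

Lemma addF2_eq0 (x y : V) : (x + y == 0) = (x == y).
Proof.
apply/eqP/eqP => [xy0|->]; last exact: addF2.
by rewrite -(addF2K x y) xy0 add0r.
Qed.

Lemma addF2_inj (t : V) : injective (fun x => x + t).
Proof. exact: addIr. Qed.

Lemma card_cV : #|{: V}| = (2 ^ n)%N.
Proof. by rewrite card_mx muln1 card_Fp. Qed.

Definition octahedral (M : {set V}) (v : 'I_6 -> V) :=
  forall i j, O6 i j -> v i + v j \in M.

(** Over F_2 an affine dependence is a vanishing sum over a nonempty set of even size; such sums do
    not change when all six vectors are translated. *)
Definition affinely_independent (v : 'I_6 -> V) :=
  forall S : {set 'I_6}, ~~ odd #|S| -> \sum_(i in S) v i = 0 -> S = set0.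

Definition independent (v : 'I_6 -> V) :=
  forall S : {set 'I_6}, \sum_(i in S) v i = 0 -> S = set0.

Lemma incidence_column_support (x : 'cV['F_2]_6) :
  x = incidence_column [set i | x i 0 == 1].
Proof.
apply/matrixP => i j; rewrite !mxE inE ord1 F2_eq1.
by case: (F2P (x i 0)) => ->.
Qed.

Lemma linear_incidence_column (f : {linear 'cV['F_2]_6 -> V}) (S : {set 'I_6}) :
  f (incidence_column S) = \sum_(i in S) f (delta_mx i 0).
Proof.
rewrite -raddf_sum; congr (f _); apply/matrixP => i j.
rewrite !mxE summxE ord1; case: (boolP (i \in S)) => iS.
  rewrite (bigD1 i) //= mxE !eqxx big1 ?addr0 // => k /andP[_ ki].
  by rewrite mxE eq_sym (negbTE ki).
rewrite big1 // => k kS; rewrite mxE.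
by case: eqP => // ik; rewrite ik kS in iS.
Qed.

Lemma mem_graphic_O6 (i j : 'I_6) :
  O6 i j -> incidence_column [set i; j] \in graphic_matroid O6.
Proof.
move=> Oij; apply/imsetP; exists [set i; j] => //.
by apply/imsetP; exists (i, j); rewrite ?inE.
Qed.

Lemma sum_pair (v : 'I_6 -> V) i j : i != j -> \sum_(k in [set i; j]) v k = v i + v j.
Proof. by move=> ij; rewrite big_setU1 ?inE //= big_set1. Qed.

Lemma O6_neq (i j : 'I_6) : O6 i j -> i != j.
Proof. by apply: contraTneq => ->; rewrite /= /multi_adj eqxx. Qed.

(** The vertices are the images of the six unit vectors: an incidence column is the sum of two of
    these, and injectivity gives independence. *)
Lemma restriction_octahedral (M : {set V}) :
  (exists S, is_restriction (graphic_matroid O6) M S) ->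
  exists v, octahedral M v /\ independent v.
Proof.
case=> S [/subsetP SM [f [f_inj defS]]]; exists (fun i => f (delta_mx i 0)).
split=> [i j Oij|T].
  apply: SM; rewrite -(sum_pair (fun k => f (delta_mx k 0))) ?O6_neq //.
  by rewrite -linear_incidence_column defS imset_f ?mem_graphic_O6.
rewrite -linear_incidence_column -(raddf0 f) => /f_inj T0.
apply/setP => i; rewrite inE; have := congr1 (fun x : 'cV_6 => x i 0) T0.
by rewrite !mxE; case: (i \in T).
Qed.

(** The matrix with columns [v i] gives the embedding. Every vector of F_2^6 is the incidence column
    of its support, so independence makes the kernel trivial. *)
Lemma octahedral_restriction (M : {set V}) (v : 'I_6 -> V) :
  octahedral M v -> independent v ->
  exists S, is_restriction (graphic_matroid O6) M S.
Proof.
move=> Ov Iv; pose A : 'M['F_2]_(n, 6) := \matrix_(k, i) v i k 0.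
pose f : {linear 'cV['F_2]_6 -> V} := mulmx A.
have f_delta i : f (delta_mx i 0) = v i.
  by rewrite /f /= -colE; apply/matrixP => k j; rewrite !mxE ord1.
have f_sum S : f (incidence_column S) = \sum_(i in S) v i.
  by rewrite linear_incidence_column; apply: eq_bigr => i _; exact: f_delta.
exists (f @: graphic_matroid O6); split; last first.
  exists f; split => //; apply: raddf_inj => x.
  change (f x = 0 -> x = 0).
  rewrite {1}[x]incidence_column_support f_sum => /Iv supp0.
  apply/matrixP => i j; rewrite ord1 mxE.
  have := in_set0 i; rewrite -supp0 inE F2_eq1 => /negbFE/eqP //.
apply/subsetP => _ /imsetP[_ /imsetP[_ /imsetP[[i j] + ->] ->] ->].
rewrite inE /= => Oij; rewrite f_sum sum_pair ?Ov //; exact: O6_neq Oij.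
Qed.

Lemma card_not_all (T : finType) (P : pred T) :
  (#|P| < #|T|)%N -> exists x, ~~ P x.
Proof.
move=> ltP; have /existsP // : [exists x, ~~ P x].
apply: contraTT ltP => /existsPn allP; rewrite -leqNgt.
by apply/subset_leq_card/subsetP => x _; have := allP x; rewrite negbK.
Qed.

(* Edges only see differences, so [v] may be translated off its odd sums. *)
Lemma affinely_independent_restriction (M : {set V}) (v : 'I_6 -> V) :
  (6 < n)%N -> octahedral M v -> affinely_independent v ->
  exists S, is_restriction (graphic_matroid O6) M S.
Proof.
move=> n6 Ov Av; pose sums := [set \sum_(i in S : {set 'I_6}) v i | S in setT].
have [t t_sums] : exists t, t \notin sums.
  (* There are at most [2 ^ 6] subset sums, fewer than the [2 ^ n] vectors. *)
  apply: card_not_all; apply: (leq_ltn_trans (leq_imset_card _ _)).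
  by rewrite -powersetT card_powerset cardsT card_ord card_cV ltn_exp2l.
apply: (@octahedral_restriction M (fun i => v i + t)) => [i j Oij|S].
  by rewrite addrACA addF2 addr0 Ov.
(* The shift enters once per index: it cancels for even [S], and for odd [S] a zero sum would make
   [t] a subset sum. *)
rewrite big_split /= sumr_const -(odd_double_half #|S|) -mul2n mulrnDr mulrnA.
rewrite mulr2n addF2 mul0rn addr0; case: (boolP (odd #|S|)) => oS; last first.
  by rewrite addr0; apply: Av.
move/eqP; rewrite addF2_eq0 => /eqP St.
by case/negP: t_sums; apply/imsetP; exists S; rewrite ?inE.
Qed.

End Vectors.

(** * Hyperplanes and their complements *)

Section HalfSpaces.
Variable n : nat.
Local Notation V := 'cV['F_2]_n.

Definition dot (w : 'rV['F_2]_n) (x : V) : 'F_2 := (w *m x) 0 0.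

Lemma dotD w x y : dot w (x + y) = dot w x + dot w y.
Proof. by rewrite /dot mulmxDr mxE. Qed.

Lemma dotDl w w' x : dot (w + w') x = dot w x + dot w' x.
Proof. by rewrite /dot mulmxDl mxE. Qed.

Lemma dot0 w : dot w 0 = 0.
Proof. by rewrite /dot mulmx0 mxE. Qed.

Lemma dot0l x : dot 0 x = 0.
Proof. by rewrite /dot mul0mx mxE. Qed.

(** For [w != 0] this is the complement [A] of the hyperplane orthogonal to [w]. *)
Definition offside (w : 'rV['F_2]_n) : {set V} := [set x | dot w x != 0].

Lemma F2D_neq0 (x y : 'F_2) : (x + y != 0) = (x != 0) (+) (y != 0).
Proof. by case: (F2P x) => ->; case: (F2P y) => ->. Qed.

Lemma offsideD w x y : (x + y \in offside w) = (x \in offside w) (+) (y \in offside w).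
Proof. by rewrite !inE dotD F2D_neq0. Qed.

Lemma offside0 w : (0 \in offside w) = false.
Proof. by rewrite inE dot0 eqxx. Qed.

Lemma dot_delta w i : dot w (delta_mx i 0) = w 0 i.
Proof. by rewrite /dot -colE mxE. Qed.

Lemma dot_delta_l i x : dot (delta_mx 0 i) x = x i 0.
Proof. by rewrite /dot -rowE mxE. Qed.

Lemma offside_nonempty w : w != 0 -> exists x, x \in offside w.
Proof.
case/rV0Pn => i wi; exists (delta_mx i 0).
by rewrite inE dot_delta.
Qed.

(** Translation by an element of [offside w] exchanges this set with its complement. *)
Lemma card_offside w : w != 0 -> (#|offside w| * 2 = 2 ^ n)%N.
Proof.
case/offside_nonempty => x0 x0w; rewrite -card_cV -(cardsC (offside w)) muln2 -addnn.
congr (_ + _)%N; rewrite -(card_imset (offside w) (@addF2_inj n x0)).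
apply: eq_card => y; rewrite inE; apply/imsetP/idP.
  by case=> x xw ->; rewrite offsideD xw x0w.
by move=> yw; exists (y + x0); rewrite ?offsideD ?x0w ?addbT ?addF2K.
Qed.

End HalfSpaces.

(** * The extremal construction *)

Section LowerBound.
Variable n : nat.
Local Notation V := 'cV['F_2]_n.

(* Subsets of the vertex set of [O6] are encoded as six-bit words. *)
Definition word_sum (v : 'I_6 -> V) (bs : seq bool) : V :=
  \sum_(i < 6) v i *+ nth false bs i.

Definition word_add (bs cs : seq bool) := [seq bc.1 (+) bc.2 | bc <- zip bs cs].

Lemma mulrb_add (x : V) (b c : bool) : x *+ b + x *+ c = x *+ (b (+) c).
Proof.
by rewrite !mulrb; case: b; case: c; rewrite /= ?addr0 ?add0r //; exact: addF2.
Qed.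

Lemma word_sumD v bs cs : size bs = 6%N -> size cs = 6%N ->
  word_sum v bs + word_sum v cs = word_sum v (word_add bs cs).
Proof.
move=> sb sc; rewrite /word_sum -big_split; apply: eq_bigr => i _ /=.
rewrite mulrb_add (nth_map (false, false)) ?size_zip ?sb ?sc //.
by rewrite nth_zip ?sb.
Qed.

Lemma word_sum_eq0 v bs : independent v -> size bs = 6%N ->
  word_sum v bs = 0 -> bs = nseq 6 false.
Proof.
move=> Iv sb bs0; have /Iv/setP S0 : \sum_(i in [set i : 'I_6 | nth false bs i]) v i = 0.
  rewrite -[RHS]bs0 /word_sum big_mkcond; apply: eq_bigr => i _ /=.
  by rewrite inE mulrb.
apply: (@eq_from_nth _ false); rewrite ?size_nseq // sb => i lti.
by have := S0 (Ordinal lti); rewrite !inE nth_nseq lti.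
Qed.

Definition edge_word (e : nat * nat) := [seq (i == e.1) || (i == e.2) | i <- iota 0 6].

Definition octahedron_edges : seq (nat * nat) :=
  [seq e <- [seq (i, j) | i <- iota 0 6, j <- iota 0 6] |
     (e.1 < e.2)%N && (e.1 %/ 2 != e.2 %/ 2)%N].

Definition same_side_edges (s : seq bool) :=
  [seq e <- octahedron_edges | nth false s e.1 == nth false s e.2].

Definition circuit_words (p q r s : seq bool) :=
  word_add (word_add p q) (word_add r s) == nseq 6 false.

(** Adding [x] to the total cancels it, so the test says that no three of the four words sum to
    zero. *)
Definition triple_free_words (p q r s : seq bool) :=
  all (fun x => word_add (word_add (word_add p q) (word_add r s)) x != nseq 6 false)
    [:: p; q; r; s].

(* For every cut of the octahedron, some side contains a 4-cycle or both sides contain a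
   path with two edges. *)
Lemma same_side_words (s : seq bool) : size s = 6%N ->
  exists p q r t, [/\ all [in map edge_word (same_side_edges s)] [:: p; q; r; t],
    uniq [:: p; q; r; t] & circuit_words p q r t || triple_free_words p q r t].
Proof.
pose E s := map edge_word (same_side_edges s).
(* The existentials become a boolean search among the uncut edges, evaluated for each of the 64
   cuts. *)
suff : has (fun p => has (fun q => has (fun r => has (fun t =>
    uniq [:: p; q; r; t] && (circuit_words p q r t || triple_free_words p q r t))
     (E s)) (E s)) (E s)) (E s) \/ size s != 6%N.
  case=> [|/negbTE/eqP //]; case/hasP=> p pE /hasP[q qE] /hasP[r rE] /hasP[t tE] /andP[u c] _.
  by exists p, q, r, t; rewrite /= pE qE rE tE.
rewrite {}/E; case: s => [|b0 [|b1 [|b2 [|b3 [|b4 [|b5 [|? ?]]]]]]]; try by right.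
left; case: b0; case: b1; case: b2; case: b3; case: b4; case: b5; vm_compute; reflexivity.
Qed.

Lemma edge_word_sum v (i j : 'I_6) : i != j ->
  word_sum v (edge_word (val i, val j)) = v i + v j.
Proof.
move=> ij; rewrite -(sum_pair v ij) /word_sum [RHS]big_mkcond; apply: eq_bigr => k _.
rewrite (nth_map 0%N) ?size_iota // nth_iota // add0n !inE mulrb /=.
by rewrite -!val_eqE.
Qed.

Lemma word_sum_inj v : independent v ->
  {in [pred bs | size bs == 6%N] &, injective (word_sum v)}.
Proof.
move=> Iv p q; rewrite !inE => /eqP sp /eqP sq /eqP.
rewrite -addF2_eq0 word_sumD // => /eqP/(word_sum_eq0 Iv).
rewrite size_map size_zip sp sq => /(_ erefl) pq0.
apply: (@eq_from_nth _ false); rewrite sp ?sq // => i lti.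
have := congr1 (fun s => nth false s i) pq0.
rewrite nth_nseq lti (nth_map (false, false)) ?size_zip ?sp ?sq //.
by rewrite nth_zip ?sp ?sq //= ; case: (nth _ p i); case: (nth _ q i).
Qed.

Variables (a b c : V) (w : 'rV['F_2]_n).
Hypotheses (aw : a \notin offside w) (bw : b \notin offside w) (cw : c \notin offside w).
Hypothesis abc_uniq : uniq [:: a; b; a + b; c].
Hypothesis c_neq0 : c != 0.

Definition extremal_set : {set V} := offside w :|: [set x in [:: a; b; a + b; c]].

Lemma card_extremal_set : #|extremal_set| = (#|offside w| + 4)%N.
Proof.
rewrite cardsU disjoint_setI0 ?cards0 ?subn0; last first.
  rewrite disjoint_sym disjoints_subset; apply/subsetP => x.
  rewrite in_setC 2!inE => xX.
  suff /allP/(_ x xX) : all [predC offside w] [:: a; b; a + b; c] by [].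
  by rewrite /= aw bw cw offsideD (negbTE aw) (negbTE bw).
by congr (_ + _)%N; rewrite cardsE; apply/card_uniqP.
Qed.

(** Four distinct members exhaust the list, and its first three entries cancel. *)
Lemma four_in_extremal (p q r s : V) : uniq [:: p; q; r; s] ->
  all [in [:: a; b; a + b; c]] [:: p; q; r; s] ->
  p + q + (r + s) = c /\ c \in [:: p; q; r; s].
Proof.
move=> u /allP sub.
have [_ eqi] := uniq_min_size u sub isT.
have peq : perm_eq [:: p; q; r; s] [:: a; b; a + b; c] by apply: uniq_perm.
split; last by rewrite eqi !inE eqxx !orbT.
have : \sum_(x <- [:: p; q; r; s]) x = \sum_(x <- [:: a; b; a + b; c]) x.
  exact: perm_big.
rewrite !big_cons !big_nil !addr0 => e.
by rewrite -addrA e addrA addrA addF2 add0r.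
Qed.

(** The cut [s] records which vertices lie in [offside w]. An uncut edge has its sum in the
    hyperplane, hence among the four added elements, so the four edges of [same_side_words] take all
    four of these values. *)
Lemma extremal_set_free : restriction_free (graphic_matroid O6) extremal_set.
Proof.
case/restriction_octahedral => v [Ov Iv].
pose s := [seq (v i \in offside w) | i <- enum 'I_6].
have ss : size s = 6%N by rewrite size_map size_enum_ord.
have word_size e : size (edge_word e) = 6%N by rewrite size_map size_iota.
have nth_s (i : 'I_6) : nth false s i = (v i \in offside w).
  by rewrite (nth_map i) ?size_enum_ord // nth_ord_enum.
have edgeX x : x \in map edge_word (same_side_edges s) ->
    size x = 6%N /\ word_sum v x \in [:: a; b; a + b; c].
  case/mapP => -[i j]; rewrite mem_filter => /andP[sij].
  rewrite mem_filter => /andP[/andP[ltij Oij] ij6] ->; split=> //; rewrite /= in sij ltij Oij.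
  have [lti ltj] : (i < 6)%N /\ (j < 6)%N.
    by case/allpairsP: ij6 => -[i' j'] [+ + [-> ->]]; rewrite !mem_iota.
  rewrite -[i]/(val (Ordinal lti)) -[j]/(val (Ordinal ltj)).
  have := Ov (Ordinal lti) (Ordinal ltj) Oij.
  rewrite edge_word_sum -?val_eqE /= ?neq_ltn ?ltij // in_setU offsideD [_ \in finset _]inE.
  have si : nth false s i = _ := nth_s (Ordinal lti).
  have sj : nth false s j = _ := nth_s (Ordinal ltj).
  by rewrite -si -sj (eqP sij) addbb.
have [p [q [r [t [/allP sub u cond]]]]] := same_side_words ss.
have {}sub x : x \in [:: p; q; r; t] -> size x = 6%N /\ word_sum v x \in [:: a; b; a + b; c].
  by move/sub/edgeX.
have [[sp pX] [sq qX]] : (size p = 6%N /\ word_sum v p \in [:: a; b; a + b; c]) /\ 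
  (size q = 6%N /\ word_sum v q \in [:: a; b; a + b; c]).
  by split; apply: sub; rewrite !inE eqxx ?orbT.
have [[sr rX] [st tX]] : (size r = 6%N /\ word_sum v r \in [:: a; b; a + b; c]) /\ 
  (size t = 6%N /\ word_sum v t \in [:: a; b; a + b; c]).
  by split; apply: sub; rewrite !inE eqxx ?orbT.
have uv : uniq [:: word_sum v p; word_sum v q; word_sum v r; word_sum v t].
  rewrite -[X in uniq X]/(map (word_sum v) [:: p; q; r; t]) map_inj_in_uniq //.
  by move=> x y /sub[sx _] /sub[sy _]; apply: (word_sum_inj Iv); rewrite inE ?sx ?sy.
have word_add_size x y : size x = 6%N -> size y = 6%N -> size (word_add x y) = 6%N.
  by move=> sx sy; rewrite size_map size_zip sx sy.
have [|sumc c_in] := four_in_extremal uv; first by rewrite /= pX qX rX tX.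
move: sumc; rewrite !word_sumD ?word_add_size // => sumc.
(* In a circuit the four would sum to zero instead of [c]; otherwise, omitting the edge with value
   [c] leaves three edges with sum zero. *)
case/orP: cond => [/eqP w0|/allP w3].
  move: sumc; rewrite w0 /word_sum big1 => [/esym/eqP|i _]; last by rewrite nth_nseq if_same.
  by rewrite (negbTE c_neq0).
have /mapP[x xin cx] : c \in map (word_sum v) [:: p; q; r; t] by [].
have [sx _] := sub x xin.
have /negP := w3 x xin; apply; apply/eqP; apply: (word_sum_eq0 Iv).
  by rewrite !word_add_size.
by rewrite -word_sumD ?word_add_size // sumc -cx addF2.
Qed.
End LowerBound.

(** * Fourier coefficients and triangles *)

Section Fourier.
Variable n : nat.
Local Notation V := 'cV['F_2]_n.
Implicit Types (M : {set V}) (w : 'rV['F_2]_n) (x y : V).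

Definition triangles M : nat := (\sum_(x in M) \sum_(y in M) (x + y \in M)%R)%N.

Definition chi w x : int := if dot w x == 0 then 1 else -1.

Lemma F2D_eq0 (x y : 'F_2) : (x + y == 0) = (x == 0) (+) ~~ (y == 0).
Proof. by case: (F2P x) => ->; case: (F2P y) => ->. Qed.

Lemma chiD w x y : chi w (x + y) = chi w x * chi w y.
Proof. by rewrite /chi dotD F2D_eq0; case: eqP; case: eqP. Qed.

Lemma chiDl w w' x : chi (w + w') x = chi w x * chi w' x.
Proof. by rewrite /chi dotDl F2D_eq0; case: eqP; case: eqP. Qed.

(** If coordinate [i] of [x] is nonzero, shifting [w] by the unit vector at [i] flips every sign, so
    the sum equals its negative. *)
Lemma sum_chi x : \sum_w chi w x = (2 ^ n * (x == 0))%:Z.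
Proof.
have [->|x0] := eqVneq x 0.
  rewrite (eq_bigr (fun=> 1)) => [|w _]; last by rewrite /chi dot0 eqxx.
  by rewrite sumr_const card_mx mul1n card_Fp // muln1 natz.
have [i xi] : exists i, x i 0 != 0 by apply/cV0Pn.
pose w0 : 'rV['F_2]_n := delta_mx 0 i.
have chi_w0 : chi w0 x = -1 by rewrite /chi dot_delta_l (negbTE xi).
suff : \sum_w chi w x = - \sum_w chi w x by rewrite muln0; lia.
rewrite [LHS](reindex_inj (addIr w0)) -sumrN; apply: eq_bigr => w _.
by rewrite chiDl chi_w0 mulrN1.
Qed.

(** The unnormalised Fourier coefficient of the indicator function of [M]. *)
Definition bias M w : int := \sum_(x in M) chi w x.

Lemma bias0 M : bias M 0 = #|M|%:Z.
Proof.
rewrite /bias (eq_bigr (fun=> 1)) => [|x _]; last by rewrite /chi dot0l eqxx.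
by rewrite sumr_const natz.
Qed.

(** Parseval: after expanding the square, orthogonality of characters leaves only the terms with
    [x = y]. *)
Lemma sum_bias2 M : \sum_w bias M w ^+ 2 = (2 ^ n * #|M|)%:Z.
Proof.
transitivity (\sum_(x in M) \sum_(y in M) \sum_w chi w (x + y)).
  rewrite (eq_bigr (fun w => \sum_(x in M) \sum_(y in M) chi w (x + y))).
    rewrite exchange_big; apply: eq_bigr => x _; exact: exchange_big.
  move=> w _; rewrite expr2 /bias mulr_suml; apply: eq_bigr => x _.
  by rewrite mulr_sumr; apply: eq_bigr => y _; rewrite chiD.
rewrite (eq_bigr (fun=> (2 ^ n)%:Z)) => [|x xM].
  by rewrite sumr_const -mulr_natr natz PoszM.
rewrite (bigD1 x) //= addF2 sum_chi eqxx muln1 big1 ?addr0 // => y /andP[_ yx].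
by rewrite sum_chi addF2_eq0 eq_sym (negbTE yx) muln0.
Qed.

(** After expanding the cube, orthogonality leaves only the terms with [z = x + y]. *)
Lemma sum_bias3 M : \sum_w bias M w ^+ 3 = (2 ^ n * triangles M)%:Z.
Proof.
transitivity (\sum_(x in M) \sum_(y in M) \sum_(z in M) \sum_w chi w (x + y + z)).
  rewrite (eq_bigr (fun w =>
    \sum_(x in M) \sum_(y in M) \sum_(z in M) chi w (x + y + z))).
    rewrite exchange_big; apply: eq_bigr => x _.
    rewrite exchange_big; apply: eq_bigr => y _; exact: exchange_big.
  move=> w _; rewrite exprS expr2 {1}/bias mulr_suml; apply: eq_bigr => x _.
  rewrite {1}/bias mulr_suml mulr_sumr; apply: eq_bigr => y _.
  by rewrite mulrA /bias mulr_sumr; apply: eq_bigr => z _; rewrite !chiD.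
rewrite /triangles PoszM -natz raddf_sum mulr_sumr; apply: eq_bigr => x _.
rewrite raddf_sum mulr_sumr; apply: eq_bigr => y _.
case: (boolP (x + y \in M)) => xyM; last first.
  rewrite mulr0 big1 // => z zM; rewrite sum_chi addF2_eq0.
  by case: eqP => [xyz|]; rewrite ?muln0 //; rewrite xyz zM in xyM.
rewrite (bigD1 (x + y)) //= addF2 sum_chi eqxx muln1 big1 ?addr0 ?mulr1 ?natz //.
by move=> z /andP[_ zxy]; rewrite sum_chi addF2_eq0 eq_sym (negbTE zxy) muln0.
Qed.

(* The cubes of the biases sum to a small number while the trivial one is large, so by
   Parseval some bias is very negative. *)
Lemma exists_negative_bias M (K : nat) :
  (2 ^ n = 16 * K)%N -> (8 * K <= #|M|)%N -> (triangles M < 4 * K ^ 2)%N ->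
  exists2 w, w != 0 & bias M w < - (7 * K)%:Z.
Proof.
move=> N16 leM ltT; apply: contrapT => noW.
have geW w : w != 0 -> - (7 * K)%:Z <= bias M w.
  by move=> w0; rewrite leNgt; apply/negP => ltw; apply: noW; exists w.
have s2 := sum_bias2 M; have s3 := sum_bias3 M.
rewrite (bigD1 0) //= bias0 in s2; rewrite (bigD1 0) //= bias0 in s3.
have : - (7 * K)%:Z * \sum_(w | w != 0) bias M w ^+ 2 <= \sum_(w | w != 0) bias M w ^+ 3.
  rewrite mulr_sumr; apply: ler_sum => w /geW lew.
  by rewrite (exprSr _ 2) mulrC ler_wpM2l ?sqr_ge0.
have -> : \sum_(w | w != 0) bias M w ^+ 2 = (2 ^ n * #|M|)%:Z - #|M|%:Z ^+ 2.
  by rewrite -s2; ring.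
have -> : \sum_(w | w != 0) bias M w ^+ 3 = 
    (2 ^ n * triangles M)%:Z - #|M|%:Z ^+ 3 by rewrite -s3; ring.
(* With [m = #|M|] the inequality reads [16 K T >= m (m^2 + 7 K m - 112 K^2)]. For [m >= 8 K] the
   right side is at least [64 K^3], against [T < 4 K^2]. *)
rewrite N16; move: (triangles M) ltT (subnKC leM) => T ltT.
move: (#|M| - 8 * K)%N => d <-; nia.
Qed.

Lemma bias_offside M w : bias M w = #|M :\: offside w|%:Z - #|M :&: offside w|%:Z.
Proof.
rewrite /bias (bigID [in offside w]) /= addrC; congr (_ + _).
  rewrite (eq_bigr (fun=> 1)) => [|x /andP[_]]; last by rewrite inE negbK /chi => ->.
  rewrite sumr_const natz; congr (Posz _); apply: eq_card => x.
  by rewrite unfold_in in_setD andbC.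
rewrite (eq_bigr (fun=> -1)) => [|x /andP[_]]; last by rewrite inE /chi => /negbTE->.
rewrite sumr_const mulNrn natz; congr (- Posz _); apply: eq_card => x.
by rewrite unfold_in in_setI.
Qed.

End Fourier.

(** * Counting octahedra by Cauchy-Schwarz *)

Section CauchySchwarz.
Local Open Scope nat_scope.

Lemma sum_square_le (I : finType) (a : I -> nat) :
  (\sum_i a i) ^ 2 <= #|I| * \sum_i a i ^ 2.
Proof.
rewrite -(leq_pmul2l (isT : 0 < 2)) -mulnn big_distrl big_distrr /=.
under eq_bigr => i _ do rewrite big_distrr /= big_distrr /=.
apply: (@leq_trans (\sum_i \sum_j (a i ^ 2 + a j ^ 2))).
  by apply: leq_sum => i _; apply: leq_sum => j _; exact: nat_Cauchy.
under eq_bigr => i _ do rewrite big_split /= sum_nat_const.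
rewrite big_split /= sum_nat_const -big_distrr /=.
by rewrite mul2n addnn.
Qed.

(** One doubling step: squaring the inner sum splits its variable into two copies over a common
    [i]. *)
Lemma double_sum_square_le (I J : finType) (F : I -> J -> nat) :
  (\sum_i \sum_j F i j) ^ 2 <= #|I| * \sum_i \sum_j \sum_k F i j * F i k.
Proof.
apply: (leq_trans (sum_square_le _)); rewrite leq_mul2l; apply/orP; right.
apply: leq_sum => i _; rewrite -mulnn big_distrl /=; apply: leq_sum => j _.
by rewrite big_distrr.
Qed.

(* Doubling the three vertex classes one after the other. *)
Lemma octahedra_count (T : finType) (F : T -> T -> T -> nat) :
  (\sum_x \sum_y \sum_z F x y z) ^ 8 <= #|T| ^ 18 *
  \sum_x0 \sum_x1 \sum_y0 \sum_y1 \sum_z0 \sum_z1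
     F x0 y0 z0 * F x0 y0 z1 * (F x0 y1 z0 * F x0 y1 z1) *
     (F x1 y0 z0 * F x1 y0 z1 * (F x1 y1 z0 * F x1 y1 z1)).
Proof.
(* [S1] has the class of [z] doubled, [S2] those of [z] and [y]; the last step doubles [x]. *)
pose S1 := \sum_x \sum_z0 \sum_z1 \sum_y F x y z0 * F x y z1.
pose S2 := \sum_y0 \sum_y1 \sum_z0 \sum_z1 \sum_x
  F x y0 z0 * F x y0 z1 * (F x y1 z0 * F x y1 z1).
have le1 : (\sum_x \sum_y \sum_z F x y z) ^ 2 <= #|T| ^ 2 * S1.
  have := double_sum_square_le (fun (p : T * T) z => F p.1 p.2 z).
  rewrite card_prod mulnn -(pair_bigA _ (fun x y => \sum_z F x y z)) /=.
  rewrite -(pair_bigA _ (fun x y => \sum_z0 \sum_z1 F x y z0 * F x y z1)) /=.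
  move=> h; apply: (leq_trans h); rewrite leq_mul2l; apply/orP; right.
  apply: leq_sum => x _; rewrite exchange_big /=; apply: leq_sum => z0 _.
  by rewrite exchange_big.
have le2 : S1 ^ 2 <= #|T| ^ 3 * S2.
  have := double_sum_square_le
    (fun (p : T * T * T) y => F p.1.1 y p.1.2 * F p.1.1 y p.2).
  rewrite !card_prod mulnn -expnSr.
  rewrite -(pair_bigA _ (fun q z1 => \sum_y F q.1 y q.2 * F q.1 y z1)) /=.
  rewrite -(pair_bigA _ (fun x z0 => \sum_z1 \sum_y F x y z0 * F x y z1)) /=.
  rewrite -(pair_bigA _ (fun q z1 => \sum_y0 \sum_y1
     F q.1 y0 q.2 * F q.1 y0 z1 * (F q.1 y1 q.2 * F q.1 y1 z1))) /=.
  rewrite -(pair_bigA _ (fun x z0 => \sum_z1 \sum_y0 \sum_y1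
     F x y0 z0 * F x y0 z1 * (F x y1 z0 * F x y1 z1))) /=.
  move=> h; apply: (leq_trans h); rewrite leq_mul2l; apply/orP; right.
  apply/eq_leq; rewrite /S2.
  transitivity (\sum_z0 \sum_z1 \sum_y0 \sum_y1 \sum_x
     F x y0 z0 * F x y0 z1 * (F x y1 z0 * F x y1 z1)).
    rewrite exchange_big; apply: eq_bigr => z0 _.
    rewrite exchange_big; apply: eq_bigr => z1 _.
    rewrite exchange_big; apply: eq_bigr => y0 _.
    by rewrite exchange_big.
  rewrite pair_bigA [RHS]pair_bigA /=.
  under eq_bigr => p _ do rewrite pair_bigA /=.
  under [RHS]eq_bigr => p _ do rewrite pair_bigA /=.
  exact: exchange_big.
(* The doublings cost factors [#|T| ^ 2], [#|T| ^ 3] and [#|T| ^ 4], which enter with powers 4, 2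
   and 1. *)
rewrite (_ : 8 = 2 * 4)%N // (_ : 18 = 8 + (6 + 4))%N // expnM.
set S3 := (X in _ <= _ * X).
have le3 : S2 ^ 2 <= #|T| ^ 4 * S3.
  have := double_sum_square_le (fun (p : (T * T) * (T * T)) x =>
    F x p.1.1 p.2.1 * F x p.1.1 p.2.2 * (F x p.1.2 p.2.1 * F x p.1.2 p.2.2)).
  rewrite !card_prod !mulnn -expnM.
  rewrite -(pair_bigA _ (fun (q r : T * T) => \sum_x
    F x q.1 r.1 * F x q.1 r.2 * (F x q.2 r.1 * F x q.2 r.2))) /=.
  rewrite -(pair_bigA _ (fun y0 y1 => \sum_(r : T * T) \sum_x
    F x y0 r.1 * F x y0 r.2 * (F x y1 r.1 * F x y1 r.2))) /=.
  under eq_bigr => y0 _ do under eq_bigr => y1 _ do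
    rewrite -(pair_bigA _ (fun z0 z1 => \sum_x
      F x y0 z0 * F x y0 z1 * (F x y1 z0 * F x y1 z1))) /=.
  move=> h; apply: (leq_trans h); rewrite leq_mul2l; apply/orP; right.
  rewrite -(pair_bigA _ (fun (q r : T * T) => \sum_x0 \sum_x1
    F x0 q.1 r.1 * F x0 q.1 r.2 * (F x0 q.2 r.1 * F x0 q.2 r.2) *
    (F x1 q.1 r.1 * F x1 q.1 r.2 * (F x1 q.2 r.1 * F x1 q.2 r.2)))) /=.
  apply/eq_leq; rewrite /S3.
  under [RHS]eq_bigr => x0 _ do under eq_bigr => x1 _ do
    (rewrite pair_bigA /=; under eq_bigr => q _ do rewrite pair_bigA /=).
  rewrite [RHS]pair_bigA [RHS]exchange_big; apply: eq_bigr => q _ /=.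
  rewrite [RHS]exchange_big; apply: eq_bigr => r _ /=.
  by rewrite pair_bigA.
apply: (@leq_trans ((#|T| ^ 2 * S1) ^ 4)); first by rewrite leq_exp2r.
rewrite expnMn -expnM expnD -mulnA leq_mul2l; apply/orP; right.
rewrite (_ : 4 = 2 * 2)%N // (expnM S1).
apply: (@leq_trans ((#|T| ^ 3 * S2) ^ 2)); first by rewrite leq_exp2r.
by rewrite expnMn -expnM expnD -mulnA leq_mul2l le3 orbT.
Qed.

End CauchySchwarz.

(** * Few octahedra in a free matroid *)

Lemma sum_nat_of_bool (T : finType) (P : pred T) :
  (\sum_x (P x : nat) = #|[set x | P x]|)%N.
Proof. by rewrite -sum1dep_card [RHS]big_mkcond; apply: eq_bigr => x _; case: (P x). Qed.

Section Degenerate.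
Variable n : nat.
Local Notation V := 'cV['F_2]_n.
Local Notation conf := {ffun 'I_6 -> V}.
Variable M : {set V}.

(** Adding any [t] at one index of [S] turns the zero sum into [t], so pairs of a solution and a [t]
    inject into all configurations. *)
Lemma card_sum_eq0 (S : {set 'I_6}) : S != set0 ->
  (#|[set v : conf | (\sum_(i in S) v i == 0)%R]| <= (2 ^ n) ^ 5)%N.
Proof.
case/set0Pn => i0 i0S; set Z := [set v | _].
rewrite -(@leq_pmul2r (2 ^ n)) ?expn_gt0 // -expnSr.
have -> : ((2 ^ n) ^ 6 = #|{: conf}|)%N by rewrite card_ffun card_cV card_ord.
rewrite -card_cV -cardsT -cardsX.
pose g (p : conf * V) : conf := [ffun i => if i == i0 then p.1 i + p.2 else p.1 i].
have g_sum p : p \in setX Z setT -> \sum_(i in S) g p i = p.2.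
  rewrite !inE andbT => /eqP p0; rewrite (bigD1 i0) //= ffunE eqxx addrAC.
  rewrite (eq_bigr p.1) => [|i /andP[_ /negbTE ii0]]; last by rewrite ffunE ii0.
  by rewrite -(bigD1 i0) // p0 add0r.
rewrite -(card_in_imset (f := g)) ?max_card // => p q pZ qZ gpq.
have pq2 : p.2 = q.2 by rewrite -(g_sum p) // gpq g_sum.
rewrite [p]surjective_pairing [q]surjective_pairing pq2; congr (_, _).
apply/ffunP => i; have /ffunP/(_ i) := gpq; rewrite !ffunE pq2.
by case: eqP => // _ /addIr.
Qed.

Definition octahedralb (v : conf) := [forall i, forall j, O6 i j ==> (v i + v j \in M)].

Lemma octahedralP (v : conf) : reflect (octahedral M v) (octahedralb v).
Proof.
apply: (iffP forallP) => [h i j Oij|h i].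
  by have /forallP/(_ j)/implyP := h i; apply.
by apply/forallP => j; apply/implyP; exact: h.
Qed.

(** Freeness makes every octahedron affinely dependent, so each has a vanishing sum over some
    nonempty [S]; the union bound runs over at most [2 ^ 6] sets. *)
Lemma card_octahedral : (6 < n)%N -> restriction_free (graphic_matroid O6) M ->
  (#|[set v | octahedralb v]| <= 2 ^ 6 * (2 ^ n) ^ 5)%N.
Proof.
move=> n6 freeM.
have sub : [set v | octahedralb v] \subset
    \bigcup_(S : {set 'I_6} | S != set0) [set v : conf | \sum_(i in S) v i == 0].
  apply/subsetP => v; rewrite inE => /octahedralP Ov; apply: contrapT => nv.
  apply: freeM; apply: (affinely_independent_restriction n6 Ov) => S _ S0.
  apply/eqP; apply: contraT => S_neq0; case: nv; apply/bigcupP; exists S => //.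
  by rewrite inE S0.
apply: (leq_trans (subset_leq_card sub)).
apply: (@leq_trans (\sum_(S : {set 'I_6} | S != set0) (2 ^ n) ^ 5)%N); last first.
  rewrite sum_nat_const leq_mul2r; apply/orP; right; apply: (leq_trans (max_card _)).
  by rewrite -cardsT -powersetT card_powerset cardsT card_ord.
elim/big_rec2: _ => [|S A B S0 leB]; first by rewrite cards0.
apply: (leq_trans (leq_card_setU _ _)); apply: leq_add => //; exact: card_sum_eq0.
Qed.

Definition triangle (x y z : V) : nat := [&& x + y \in M, y + z \in M & x + z \in M].

(** Translating [y] and [z] by [x] turns the three conditions into [y], [y + z], [z] in [M], with
    [x] free. *)
Lemma sum_triangle :
  (\sum_x \sum_y \sum_z triangle x y z = 2 ^ n * triangles M)%N.
Proof.
rewrite -card_cV -sum_nat_const; apply: eq_bigr => x _.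
rewrite (reindex_inj (addrI x)) /triangles [RHS]big_mkcond; apply: eq_bigr => y _ /=.
rewrite (reindex_inj (addrI x)) /=.
case: (boolP (y \in M)) => yM.
  rewrite [RHS]big_mkcond; apply: eq_bigr => z _.
  rewrite /triangle addrACA !(addrA x x) addF2 !add0r yM andTb.
  by case: (z \in M); rewrite ?andbT ?andbF.
by apply: big1 => z _; rewrite /triangle addrA addF2 add0r (negbTE yM).
Qed.

Lemma sum_octahedra :
  (\sum_x0 \sum_x1 \sum_y0 \sum_y1 \sum_z0 \sum_z1
     triangle x0 y0 z0 * triangle x0 y0 z1 * (triangle x0 y1 z0 * triangle x0 y1 z1) *
     (triangle x1 y0 z0 * triangle x1 y0 z1 * (triangle x1 y1 z0 * triangle x1 y1 z1))
   <= #|[set v | octahedralb v]|)%N.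
Proof.
rewrite !pair_bigA /=.
pose tup (p : V * V * V * V * V * V) :=
  [:: p.1.1.1.1.1; p.1.1.1.1.2; p.1.1.1.2; p.1.1.2; p.1.2; p.2].
pose g p : conf := [ffun i : 'I_6 => nth 0 (tup p) i].
have g_inj : injective g.
  case=> [[[[[x0 x1] y0] y1] z0] z1] [[[[[x0' x1'] y0'] y1'] z0'] z1'] /ffunP e.
  have := e (inord 0); have := e (inord 1); have := e (inord 2); have := e (inord 3).
  have := e (inord 4); have := e (inord 5).
  by rewrite !ffunE !inordK //= => -> -> -> -> -> ->.
apply: (@leq_trans (\sum_p (octahedralb (g p) : nat))%N); last first.
  rewrite sum_nat_of_bool -(card_imset _ g_inj); apply/subset_leq_card/subsetP.
  by move=> _ /imsetP[p + ->]; rewrite !inE.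
apply: leq_sum => -[[[[[x0 x1] y0] y1] z0] z1] _ /=.
rewrite /triangle !mulnb; set b := (X in (nat_of_bool X <= _)%N).
suff : b ==> octahedralb (g (x0, x1, y0, y1, z0, z1)).
  by case: b => //= ->.
rewrite /b; apply/implyP.
(* The eight triangles give 24 memberships, two for each of the 12 edges. *)
rewrite -!andbA; do 23!case/andP=> ?; move=> ?.
apply/octahedralP; do 2!case=> [[|[|[|[|[|[|//]]]]]] ?]; rewrite !ffunE //= => _;
  first [assumption | by rewrite addrC].
Qed.

End Degenerate.

(** The hypotheses chain to [N ^ 24 <= c ^ 8 (N T) ^ 8 <= c ^ 9 N ^ 23]. *)
Lemma degree_count (N T c : nat) : (0 < N)%N -> (N ^ 2 <= c * T)%N ->
  ((N * T) ^ 8 <= N ^ 18 * (c * N ^ 5))%N -> (N <= c ^ 9)%N.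
Proof.
move=> N0 leT cs; have N23 : (0 < N ^ 23)%N by rewrite expn_gt0 N0.
rewrite -(leq_pmul2l N23) -expnSr.
apply: (@leq_trans ((N * (c * T)) ^ 8)).
  by rewrite (_ : 24 = 3 * 8)%N // expnM leq_exp2r // expnS leq_mul2l leT orbT.
rewrite mulnCA expnMn; apply: (leq_trans (leq_mul (leqnn _) cs)).
by rewrite (_ : 23 = 18 + 5)%N // expnD (expnS c 8); apply/eq_leq; ring.
Qed.

(** * The upper bound *)

Ltac F2_vector := apply/matrixP => ? ?; rewrite !mxE;
  repeat match goal with |- context [fun_of_matrix ?x ?i ?j] =>
    case: (F2P (fun_of_matrix x i j)) => -> end; by apply/eqP.

Section UpperBound.
Variable n : nat.
Local Notation V := 'cV['F_2]_n.
Implicit Types (M X : {set V}) (w : 'rV['F_2]_n).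

Lemma few_triangles M : (54 < n)%N -> restriction_free (graphic_matroid O6) M ->
  (2 ^ 6 * triangles M < (2 ^ n) ^ 2)%N.
Proof.
move=> n54 freeM; rewrite ltnNge; apply/negP => leT.
have n6 : (6 < n)%N by apply: leq_trans n54.
have := octahedra_count (triangle M); rewrite sum_triangle card_cV => cs.
have few := leq_trans (sum_octahedra M) (card_octahedral n6 freeM).
have {}cs := leq_trans cs (leq_mul (leqnn _) few).
(* With [c = 2 ^ 6] this yields [2 ^ n <= 2 ^ 54]. *)
have := degree_count (expn_gt0 2 n) leT cs.
by rewrite -expnM leq_exp2l // leqNgt n54.
Qed.

(** Translation by [s] in the hyperplane preserves [offside w], so each [s] spoils at most as many
    [y] as [M] misses there. *)
Lemma card_common_translates M w (ss : seq V) :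
  all [predC offside w] ss ->
  (#|offside w| <= #|[set y in offside w | all (fun s => (y + s)%R \in M) ss]|
                 + size ss * #|offside w :\: M|)%N.
Proof.
elim: ss => [|s ss IH] /=.
  by rewrite mul0n addn0 => _; apply/subset_leq_card/subsetP => y yw; rewrite inE yw.
case/andP => sw /IH{}IH; apply: (leq_trans IH); rewrite mulSn addnA leq_add2r.
set A := [set y in _ | _]; set B := [set y in _ | _].
have sub : A \subset B :|: [set y + s | y in offside w :\: M].
  apply/subsetP => y; rewrite in_setU [y \in A]inE [y \in B]inE => /andP[yw ->].
  rewrite yw andbT /=; case: (boolP (y + s \in M)) => //= ysM.
  apply/imsetP; exists (y + s); rewrite ?addF2K // inE ysM offsideD yw.
  by rewrite (negbTE sw).
apply: (leq_trans (subset_leq_card sub)); apply: (leq_trans (leq_card_setU _ _)).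
by rewrite leq_add2l leq_imset_card.
Qed.

Definition span3 (a b c : V) : seq V :=
  [:: 0; a; b; a + b; c; a + c; b + c; a + b + c].

Definition independent3 (a b c : V) :=
  [&& a != 0, b != 0, c != 0, a + b != 0, a + c != 0, b + c != 0 & a + b + c != 0].

Lemma exists_notin X (s : seq V) : (size s < #|X|)%N -> exists2 x, x \in X & x \notin s.
Proof.
move=> lts; apply: contrapT => nex; move: lts; rewrite ltnNge => /negP; apply.
apply: leq_trans (card_size s); apply/subset_leq_card/subsetP => x xX.
by apply: contrapT => /negP xs; apply: nex; exists x.
Qed.

(** Take independent [a], [b], [c] in [X]. If neither alternative holds for them, every other
    element is a sum of two of them, and two such sums exist. *)
Lemma circuit_or_independent X : 0 \notin X -> (4 < #|X|)%N ->
  exists a b c, independent3 a b c /\ [/\ a \in X, b \in X & c \in X] /\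
   (a + b + c \in X \/ exists2 d, d \in X & d \notin span3 a b c).
Proof.
move=> X0 X5; have Xneq0 x : x \in X -> x != 0 by apply: contraTneq => ->.
have [a aX _] : exists2 x, x \in X & x \notin [::] by apply: exists_notin; apply: leq_trans X5.
have [b bX ba] : exists2 x, x \in X & x \notin [:: a].
  by apply: exists_notin; apply: leq_trans X5.
have [c cX cab] : exists2 x, x \in X & x \notin [:: a; b; a + b].
  by apply: exists_notin; apply: leq_trans X5.
have abc : independent3 a b c.
  move: ba cab; rewrite !inE !negb_or => ba /and3P[ca cb cab].
  rewrite /independent3 (Xneq0 a) ?(Xneq0 b) ?(Xneq0 c) //= !addF2_eq0.
  by rewrite -!(eq_sym c) ca cb cab eq_sym ba.
case: (boolP (a + b + c \in X)) => abcX; first by exists a, b, c; do ?split => //; left.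
have [[d dX dabc]|sub] := EM (exists2 d, d \in X & d \notin span3 a b c).
  by exists a, b, c; do ?split => //; right; exists d.
have {}sub x : x \in X -> x \notin [:: a; b; c] -> x \in [:: a + b; a + c; b + c].
  move=> xX; have : x \in span3 a b c.
    by apply: contrapT => /negP xs; apply: sub; exists x.
  rewrite !inE (negbTE (Xneq0 x xX)) /=; case: eqP => //= _; case: eqP => //= _.
  case: (x =P a + b) => //= _; case: (x =P c) => //= _; case: (x =P a + c) => //= _.
  case: (x =P b + c) => //= _ /eqP xabc; by rewrite -xabc xX in abcX.
have [x xX xabc] : exists2 x, x \in X & x \notin [:: a; b; c].
  by apply: exists_notin; apply: leq_trans X5.
have [y yX yabc] : exists2 y, y \in X & y \notin [:: x; a; b; c].
  by apply: exists_notin; apply: leq_trans X5.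
move: yabc; rewrite in_cons negb_or => /andP[yx /(sub y yX) yin].
have {xabc}xin := sub x xX xabc.
case/and5P: abc => a0 b0 c0 ab0 /and3P[ac0 bc0 abc0].
have bab : a + b + b + c = a + c by rewrite addF2K.
have aab : a + b + a + c = b + c by rewrite (addrAC a b a) addF2 add0r.
have aac : a + c + a + b = b + c by rewrite (addrAC a c a) addF2 add0r addrC.
have ind1 : independent3 (a + b) b c.
  by rewrite /independent3 bab addF2K ab0 b0 c0 a0 abc0 bc0 ac0.
have ind2 : independent3 (a + b) a c.
  by rewrite /independent3 aab (addrAC a b a) addF2 add0r ab0 b0 c0 a0 abc0 bc0 ac0.
have ind3 : independent3 (a + c) a b.
  rewrite /independent3 aac (addrAC a c a) addF2 add0r (addrAC a c b) ab0 b0 c0 a0 abc0.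
  by rewrite bc0 ac0.
(* Any two of the three pairwise sums form a 4-circuit with two of [a], [b], [c]. *)
move: xin yin; rewrite !inE => /or3P[] /eqP xE /or3P[] /eqP yE; subst x y;
  rewrite ?eqxx // in yx;
  by [ exists (a + b), b, c; do ?split => //; left; rewrite bab
     | exists (a + b), a, c; do ?split => //; left; rewrite aab
     | exists (a + c), a, b; do ?split => //; left; rewrite aac ].
Qed.

Definition conf6 (v0 v1 v2 v3 v4 v5 : V) (i : 'I_6) : V :=
  nth 0 [:: v0; v1; v2; v3; v4; v5] i.

Lemma conf6_octahedral M v0 v1 v2 v3 v4 v5 :
  all [in M] [:: v0 + v2; v0 + v3; v0 + v4; v0 + v5; v1 + v2; v1 + v3; v1 + v4; v1 + v5;
                 v2 + v4; v2 + v5; v3 + v4; v3 + v5] ->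
  octahedral M (conf6 v0 v1 v2 v3 v4 v5).
Proof.
rewrite /= andbT; do 11!case/andP=> ?; move=> ?.
do 2!case=> [[|[|[|[|[|[|//]]]]]] ?]; rewrite /conf6 //= => _;
  first [assumption | by rewrite addrC].
Qed.

(** Six bits encode [S], with exclusive or as its parity, which opens the condition to case
    analysis. *)
Lemma conf6_affinely_independent v0 v1 v2 v3 v4 v5 :
  (forall b0 b1 b2 b3 b4 b5 : bool,
    ~~ (b0 (+) b1 (+) b2 (+) b3 (+) b4 (+) b5) ->
    v0 *+ b0 + v1 *+ b1 + v2 *+ b2 + v3 *+ b3 + v4 *+ b4 + v5 *+ b5 = 0 ->
    ~~ [|| b0, b1, b2, b3, b4 | b5]) ->
  affinely_independent (conf6 v0 v1 v2 v3 v4 v5).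
Proof.
move=> H S; rewrite -sum1_card big_mkcond [X in X = 0 -> _]big_mkcond.
rewrite !big_ord_recr !big_ord0 /conf6 /= add0n add0r -!mulrb.
move=> oddS /H{}H; apply/setP => i; rewrite [RHS]inE; apply/negbTE.
have key j : val i = val j -> j \notin S -> i \notin S by move/val_inj ->.
lapply H; last by move: oddS; rewrite !mulrb; do 6!case: (_ \in S).
rewrite !negb_or => /andP[h0 /and5P[h1 h2 h3 h4 h5]].
move: key; case: {H}i => [[|[|[|[|[|[|//]]]]]] lti] key;
  first [exact: key h0 | exact: key h1 | exact: key h2 | exact: key h3
       | exact: key h4 | exact: key h5].
Qed.

Lemma mulrb_offside w x (b : bool) : (x *+ b \in offside w) = b && (x \in offside w).
Proof. by rewrite mulrb; case: b; rewrite ?offside0. Qed.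

Lemma independent3P a b c (p q r : bool) : independent3 a b c ->
  a *+ p + b *+ q + c *+ r = 0 -> ~~ [|| p, q | r].
Proof.
case/and5P=> a0 b0 c0 ab0 /and3P[ac0 bc0 abc0]; rewrite !mulrb.
by case: p; case: q; case: r; rewrite ?addr0 ?add0r // => /eqP; apply: contraLR.
Qed.

Lemma mem_span3 a b c (p q r : bool) : a *+ p + b *+ q + c *+ r \in span3 a b c.
Proof.
by rewrite !mulrb !inE; case: p; case: q; case: r; rewrite ?addr0 ?add0r eqxx ?orbT.
Qed.

(* The 4-circuit is the cycle 2-4-3-5, and the pair 0, 1 lies on the other side. *)
Lemma circuit_restriction M w a b c : (6 < n)%N ->
  (8 < #|offside w| - 4 * #|offside w :\: M|)%N ->
  all [predC offside w] [:: a; b; c] -> independent3 a b c ->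
  all [in M] [:: a; b; c; a + b + c] ->
  exists S, is_restriction (graphic_matroid O6) M S.
Proof.
move=> n6 big /and4P[aw bw cw _] ind /and5P[aM bM cM dM _].
(* The shifts are the vertices of the 4-cycle; both [y] and [z] must be joined to all of them. *)
have := @card_common_translates M w [:: 0; a; a + b; a + b + c].
rewrite /= !offsideD offside0 (negbTE aw) (negbTE bw) (negbTE cw) => /(_ isT).
set Y := [set y in _ | _] => leY.
have Y8 : (8 < #|Y|)%N by apply: leq_trans big _; rewrite leq_subLR addnC.
have [y yY _] : exists2 y, y \in Y & y \notin [::].
  by apply: exists_notin; apply: leq_trans Y8.
(* Avoiding the eight vectors of [y] plus the span needs more than 8 candidates. *)
have [z zY zspan] : exists2 z, z \in Y & z \notin map (+%R y) (span3 a b c).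
  by apply: exists_notin; rewrite size_map.
move: yY zY; rewrite [y \in Y]inE [z \in Y]inE.
case/and5P=> yw y1 y2 y3 /andP[y4 _] /and5P[zw z1 z2 z3 /andP[z4 _]].
apply: (@affinely_independent_restriction _ M (conf6 y z 0 (a + b) a (a + b + c))) => //.
  apply: conf6_octahedral.
  rewrite /= y1 y2 y3 y4 z1 z2 z3 z4 !add0r aM dM.
  by rewrite (addrAC a b a) addF2 add0r bM addrA addF2 add0r cM.
apply: conf6_affinely_independent => b0 b1 b2 b3 b4 b5 par sum0.
(* Only [y] and [z] lie in [offside w], so a zero sum uses both or neither. *)
have b01 : b0 = b1.
  have := offside0 w; rewrite -sum0 !offsideD !mulrb_offside !offsideD offside0.
  rewrite yw zw (negbTE aw) (negbTE bw) (negbTE cw) !andbF !andbT !addbF.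
  by case: (b0) (b1) => -[].
have comb : a *+ (b3 (+) b4 (+) b5) + b *+ (b3 (+) b5) + c *+ b5 =
   (a + b) *+ b3 + a *+ b4 + (a + b + c) *+ b5.
  by case: (b3); case: (b4); case: (b5); rewrite !mulrb /=; F2_vector.
have {}sum0 : y *+ b0 + z *+ b1 + ((a + b) *+ b3 + a *+ b4 + (a + b + c) *+ b5) = 0.
  by rewrite -[RHS]sum0 mul0rn addr0 !addrA.
rewrite -{}comb in sum0; move: par sum0; rewrite -{}b01; case: b0 => par.
  rewrite !mulr1n => /eqP; rewrite (addrC y) -addrA addF2_eq0 => /eqP zE.
  by case/negP: zspan; rewrite zE map_f // mem_span3.
rewrite !mulr0n !add0r => /(independent3P ind).
by move: par; case: b2; case: b3; case: b4; case: b5.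
Qed.

(* The independent elements are the paths 0-2-1 and 4-3-5 on the two sides. *)
Lemma independent_restriction M w a b c d : (6 < n)%N ->
  (0 < #|offside w| - 8 * #|offside w :\: M|)%N ->
  all [predC offside w] [:: a; b; c; d] -> independent3 a b c -> d \notin span3 a b c ->
  all [in M] [:: a; b; c; d] ->
  exists S, is_restriction (graphic_matroid O6) M S.
Proof.
move=> n6 big /and5P[aw bw cw dw _] ind dspan /and5P[aM bM cM dM _].
(* Each of the eight octahedron edges across the cut is [y] plus one of these shifts. *)
have := @card_common_translates M w
  [:: a; a + c; a + d; b; b + c; b + d; c; d].
rewrite /= !offsideD (negbTE aw) (negbTE bw) (negbTE cw) (negbTE dw) => /(_ isT).
set Y := [set y in _ | _] => leY.
have Y1 : (0 < #|Y|)%N by apply: leq_trans big _; rewrite leq_subLR addnC.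
have [y yY _] : exists2 y, y \in Y & y \notin [::] by apply: exists_notin.
move: yY; rewrite [y \in Y]inE.
case/and5P=> yw y1 y2 y3 /and5P[y4 y5 y6 y7 /andP[y8 _]].
apply: (@affinely_independent_restriction _ M (conf6 a b 0 y (y + c) (y + d))) => //.
  apply: conf6_octahedral; rewrite /= !addr0 !add0r aM bM y7 y8.
  rewrite (addrC a y) (addrC b y) y1 y4 (addrCA a) (addrCA b) y2 y5.
  by rewrite (addrCA a) (addrCA b) y3 y6 !addrA addF2 !add0r cM dM.
apply: conf6_affinely_independent => b0 b1 b2 b3 b4 b5 par sum0.
(* The vertices 3, 4, 5 are those in [offside w]; using an even number of them cancels [y]. *)
have b345 : b3 = b4 (+) b5.
  have := offside0 w; rewrite -sum0 !offsideD !mulrb_offside !offsideD offside0.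
  rewrite yw (negbTE aw) (negbTE bw) (negbTE cw) (negbTE dw) !andbF !andbT !addbF.
  by case: (b3) (b4) (b5) => -[] [].
have {}sum0 : d *+ b5 + (a *+ b0 + b *+ b1 + c *+ b4) = 0.
  rewrite -[RHS]sum0 b345.
  by case: (b0); case: (b1); case: (b4); case: (b5); rewrite !mulrb /= ?if_same; F2_vector.
move: par sum0; rewrite {}b345; case: b5 => par.
  rewrite mulr1n => /eqP; rewrite addF2_eq0 => /eqP dE.
  by case/negP: dspan; rewrite dE mem_span3.
rewrite mulr0n add0r => /(independent3P ind).
by move: par; case: b0; case: b1; case: b2; case: b4.
Qed.

Lemma extremal_bound M : (54 < n)%N -> is_matroid M ->
  restriction_free (graphic_matroid O6) M -> (#|M| <= 2 ^ (n - 1) + 4)%N.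
Proof.
move=> n54 M0 freeM; rewrite leqNgt; apply/negP => ltM.
have n6 : (6 < n)%N by apply: leq_trans n54.
(* With this sixteenth of [2 ^ n], [few_triangles] becomes [triangles M < 4 * K ^ 2]. *)
pose K := (2 ^ (n - 4))%N.
have NK : (2 ^ n = 16 * K)%N by rewrite -(expnD 2 4); congr expn; lia.
have NK1 : (2 ^ (n - 1) = 8 * K)%N by rewrite -(expnD 2 3); congr expn; lia.
have K4 : (4 <= K)%N by rewrite -[4%N]/(2 ^ 2)%N leq_exp2l //; lia.
have [||w w0] := @exists_negative_bias n M K NK; first by rewrite -NK1; lia.
  have := few_triangles n54 freeM; rewrite NK; move: (triangles M) => T; nia.
rewrite bias_offside; have := card_offside w0; rewrite NK => cardA biasw.
have := cardsID M (offside w); have := cardsID (offside w) M; rewrite (setIC (offside w)).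
move=> cardM cardO; set X := M :\: offside w in cardM biasw.
(* As [offside w] has [8 K] elements, the size of [M] forces five into [X], and the bias below
   [- 7 K] leaves fewer than [K] missing. *)
have X5 : (4 < #|X|)%N by lia.
have ltD : (#|offside w :\: M| < K)%N by lia.
have X0 : 0 \notin X by rewrite inE (negbTE M0) andbF.
apply: freeM; have [a [b [c [ind [[aX bX cX] abc]]]]] := circuit_or_independent X0 X5.
have XM x : x \in X -> x \in M by case/setDP.
have Xw x : x \in X -> x \notin offside w by case/setDP.
case: abc => [dX|[d dX dspan]].
  apply: (@circuit_restriction M w _ _ _ n6 _ _ ind); first by lia.
    by rewrite /= !Xw.
  by rewrite /= !XM.
apply: (@independent_restriction M w _ _ _ _ n6 _ _ ind dspan); first by lia.
  by rewrite /= !Xw.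
by rewrite /= !XM.
Qed.

End UpperBound.

(* The two bounds combined *)
Close Scope ring_scope.

Theorem theorem1p7 :
  exists n0 : nat, forall n : nat, n0 <= n ->
    ex_num (graphic_matroid O6) n = 2 ^ (n - 1) + 4.
Proof.
Open Scope ring_scope.
(* The threshold comes from [54 < n] in [extremal_bound]. *)
exists 55%N => n n54; apply/eqP; rewrite eqn_leq; apply/andP; split.
  apply/bigmax_leqP => M /andP[M0 /asboolP freeM]; exact: extremal_bound.
(* Four coordinates suffice: [w] reads coordinate 0, and the unit vectors at 1, 2, 3 in its
   hyperplane serve as [a], [b], [c]. *)
case: n n54 => [|[|[|[|k]]]] // _; set n := k.+4.
pose e i : 'cV['F_2]_n := delta_mx (inord i) 0.
pose w : 'rV['F_2]_n := delta_mx 0 (inord 0).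
have e_coord i j : (i < 4)%N -> (j < 4)%N -> e i (inord j) 0 = (i == j)%:R.
  move=> i4 j4; rewrite mxE andbT -val_eqE /= !inordK 1?eq_sym //.
    exact: leq_trans i4 _.
  exact: leq_trans j4 _.
have coordD (x y : 'cV['F_2]_n) i : (x + y) i 0 = x i 0 + y i 0 by rewrite mxE.
have neq_at (x y : 'cV['F_2]_n) i : x i 0 != y i 0 -> x != y by apply: contraNneq => ->.
have ew i : (0 < i < 4)%N -> e i \notin offside w.
  by case/andP=> i0 i4; rewrite inE negbK dot_delta_l e_coord // -(eq_sym 0%N) ltn_eqF.
have w0 : w != 0 by apply/rV0Pn; exists (inord 0); rewrite mxE !eqxx.
have e0 i : (i < 4)%N -> e i != 0.
  by move=> i4; apply: (neq_at _ _ (inord i)); rewrite e_coord // mxE eqxx.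
have e120 : e 1%N + e 2%N != 0.
  by apply: (neq_at _ _ (inord 1)); rewrite coordD !e_coord // mxE.
have uniq_e : uniq [:: e 1%N; e 2%N; e 1%N + e 2%N; e 3%N].
  rewrite /= !inE !negb_or !andbT; apply/and3P; split.
  - by apply/and3P; split; [apply: (neq_at _ _ (inord 1)) | apply: (neq_at _ _ (inord 2))
      | apply: (neq_at _ _ (inord 1))]; rewrite ?coordD !e_coord.
  - by apply/andP; split; [apply: (neq_at _ _ (inord 1)) | apply: (neq_at _ _ (inord 2))];
      rewrite ?coordD !e_coord.
  - by apply: (neq_at _ _ (inord 1)); rewrite ?coordD !e_coord.
have cardw : #|offside w| = (2 ^ (n - 1))%N.
  by have := card_offside w0; rewrite /n subn1 /= (expnS 2 k.+3); lia.
rewrite -cardw -(@card_extremal_set _ (e 1%N) (e 2%N) (e 3%N) w) ?ew //.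
apply: (@leq_bigmax_cond _ _ (fun M : {set 'cV['F_2]_n} => #|M|)).
apply/andP; split.
  rewrite /is_matroid in_setU negb_or offside0 [0 \in finset _]inE !inE !negb_or.
  by rewrite !(eq_sym 0) !e0 // e120.
by apply/asboolP; apply: extremal_set_free; rewrite ?ew ?e0.
Qed.
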